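(* Let $n\ge 1$ and let $\Delta=(\Delta_{ij})$ be an integer $n\times n$ matrix such that $\det\Delta\neq 0$, $\Delta_{ij}\le 0$ for all $i\ne j$, and there exists a vector $\mathbf r\in\mathbb Z^n$ with $\mathbf r>0$ and $\mathbf r\Delta\ge 0$. Let $\mathbf r\in\mathscr R(\Delta)$. A configuration $\mathbf u$ is a recurrent configuration if and only if it is stable and $\mathbf r$-allowed.
   Context: Vectors are row vectors. $\mathbf r>0$ means $r_i>0$ for all $i$; $\mathbf r\ge \mathbf r'$ means $r_i\ge r'_i$ for all $i$. $\mathscr R(\Delta)=\{\mathbf r\in\mathbb Z^n : \mathbf r>0,\ \mathbf r\Delta\ge 0\}$. For $\mathbf r\in\mathscr R(\Delta)$, $\Omega(\mathbf r)$ is the set of integer vectors $\chi=(\chi(1),\dots,\chi(n))$ with $0\le\chi(i)\le r_i$ for every $i$ and $\chi(i)\ne 0$ for some $i$. $\Delta^j$ is the $j$-th column of $\Delta$, $\Delta_i$ is the $i$-th row of $\Delta$, and $\langle X,Y\rangle=\sum_{i=1}^n X_iY_i$. A configuration is a row vector $\mathbf u\in\mathbb Z^n$ with $u_i\ge 0$ for all $i$. A vertex $i\in\{1,\dots,n\}$ is critical for $\mathbf u$ if $u_i\ge\Delta_{ii}$; $\mathbf u$ is stable if no vertex is critical, i.e. $0\le u_i<\Delta_{ii}$ for all $i$. Toppling a critical vertex $i$ replaces $\mathbf u$ by $\mathbf u-\Delta_i$. A sequence of topplings from $\mathbf u$ is a sequence $i_1,\dots,i_k$ such that $i_j$ is critical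 for $\mathbf u-\Delta_{i_1}-\cdots-\Delta_{i_{j-1}}$ for each $1\le j\le k$; it transforms $\mathbf u$ into $\mathbf u-\sum_{j=1}^k\Delta_{i_j}$. For such $\Delta$ it is known (Dhar) that every configuration can be transformed into a stable configuration by a sequence of topplings, and that this stable configuration does not depend on the order of topplings. For $1\le i\le n$, the avalanche operator $A_i$ maps a stable configuration $\mathbf u$ to the stable configuration obtained by increasing $u_i$ by $1$ and then performing a sequence of topplings leading to a stable configuration. A stable configuration $\mathbf u$ is called recurrent if there are positive integers $c_1,\dots,c_n$ such that $A_i^{c_i}\mathbf u=\mathbf u$ for all $i$. A configuration $\mathbf u=(u_1,\dots,u_n)$ is $\mathbf r$-allowed if for any $\chi\in\Omega(\mathbf r)$ there exists a vertex $j$ with $\chi(j)\ge 1$ such that $u_j\ge\Delta_{jj}-\langle\chi,\Delta^j\rangle$. *)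

(* Defs.v *)
From mathcomp Require Import all_boot all_order all_algebra.
From Stdlib Require Import ClassicalEpsilon.

Set Implicit Arguments.
Unset Strict Implicit.
Unset Printing Implicit Defensive.

Import Order.TTheory GRing.Theory Num.Theory.
Local Open Scope ring_scope.

Definition in_scrR (n : nat) (Delta : 'M[int]_n) (r : 'rV[int]_n) : Prop :=
  (forall i, 0 < r 0 i) /\ (forall j, 0 <= (r *m Delta) 0 j).

Definition in_Omega (n : nat) (r chi : 'rV[int]_n) : Prop :=
  (forall i, 0 <= chi 0 i <= r 0 i) /\ (exists i, chi 0 i != 0).

Definition configuration (n : nat) (u : 'rV[int]_n) : Prop :=
  forall i, 0 <= u 0 i.

Definition critical (n : nat) (Delta : 'M[int]_n) (u : 'rV[int]_n) (i : 'I_n) :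
  bool := Delta i i <= u 0 i.

Definition stable (n : nat) (Delta : 'M[int]_n) (u : 'rV[int]_n) : Prop :=
  configuration u /\ (forall i, ~~ critical Delta u i).

Definition topple (n : nat) (Delta : 'M[int]_n) (u : 'rV[int]_n) (i : 'I_n) :
  'rV[int]_n := u - row i Delta.

Fixpoint legal_topplings (n : nat) (Delta : 'M[int]_n) (u : 'rV[int]_n)
    (s : seq 'I_n) : bool :=
  if s is i :: s' then
    critical Delta u i && legal_topplings Delta (topple Delta u i) s'
  else true.

Definition topples_to (n : nat) (Delta : 'M[int]_n) (u v : 'rV[int]_n) : Prop :=
  exists s : seq 'I_n,
    legal_topplings Delta u s /\ v = foldl (topple Delta) u s.

(* [epsilon] picks a stable configuration reachable from [u] by topplings. For
   the matrices considered here and any configuration [u], it exists and is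
   unique (Dhar), so no arbitrary choice is involved; otherwise the value is
   unspecified. *)
Definition stabilization (n : nat) (Delta : 'M[int]_n) (u : 'rV[int]_n) :
    'rV[int]_n :=
  epsilon (inhabits u) (fun v => topples_to Delta u v /\ stable Delta v).

Definition avalanche (n : nat) (Delta : 'M[int]_n) (i : 'I_n)
    (u : 'rV[int]_n) : 'rV[int]_n :=
  stabilization Delta (u + delta_mx 0 i).

Definition recurrent (n : nat) (Delta : 'M[int]_n) (u : 'rV[int]_n) : Prop :=
  stable Delta u /\
  exists c : 'I_n -> nat,
    forall i, (0 < c i)%N /\ iter (c i) (avalanche Delta i) u = u.

Definition allowed (n : nat) (Delta : 'M[int]_n) (r u : 'rV[int]_n) : Prop :=
  configuration u /\
  forall chi : 'rV[int]_n, in_Omega r chi ->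
    exists j : 'I_n, 1 <= chi 0 j /\
      Delta j j - \sum_(i < n) chi 0 i * Delta i j <= u 0 j.

(* Main.v *)
Require Import Defs.
From mathcomp Require Import all_boot all_order all_algebra.
From mathcomp Require Import zify.
From Stdlib Require Import ClassicalEpsilon.

Set Implicit Arguments.
Unset Strict Implicit.
Unset Printing Implicit Defensive.

(** Write M for the toppling matrix. The hypotheses make M a nonsingular
    M-matrix, so its inverse is nonnegative and topplings terminate. By the
    least action principle, a legal toppling sequence from u has score at most
    any z >= 0 for which u - z M has no critical vertex.

    Suppose u + z M topples back to u, with z > 0 and z M >= 0. Then so does
    u + m z M, with score m z; if chi is nonnegative, nonzero and at most m z,
    least action forbids u + m z M - (m z - chi) M = u + chi M from being free
    of critical vertices. A recurrent u has such a z, whence u is allowed.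
    Conversely, if u is r-allowed then u + r M topples back to u (otherwise
    chi = r - score contradicts allowedness), so z = r works. With
    D = |det M|, the vector D e_i equals b M for some b >= 0, and u + D e_i
    stabilizes to u + chi M with chi = b - score >= 0; hence chi = 0 and the
    D-th iterate of each avalanche operator fixes u. *)

Import Order.TTheory GRing.Theory Num.Theory.
Local Open Scope ring_scope.

(** * Nonsingularity and the nonnegative inverse *)

(** [M] need not be invertible over [R]: multiply by the adjugate and cancel the determinant. *)
Lemma det_mulmx_inj (R : idomainType) (m n : nat) (M : 'M[R]_n) :
  \det M != 0 -> injective (fun x : 'M[R]_(m, n) => x *m M).
Proof.
move=> dM x y /(congr1 (mulmx^~ (\adj M))).
rewrite -!mulmxA mul_mx_adj !mul_mx_scalar => /matrixP exy.
by apply/matrixP => i j; apply: (mulfI dM); have := exy i j; rewrite !mxE.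
Qed.

Lemma det_mulmx_eq0 (R : idomainType) (n m : nat) (M : 'M[R]_n) (y : 'M[R]_(n, m)) :
  \det M != 0 -> M *m y = 0 -> y = 0.
Proof.
move=> dM /(congr1 (mulmx (\adj M))); rewrite mulmxA mul_adj_mx mulmx0.
rewrite mul_scalar_mx => /matrixP y0; apply/matrixP => i j; apply: (mulfI dM).
by have := y0 i j; rewrite !mxE mulr0.
Qed.

Lemma mulmx_ge0_inv (n : nat) (M : 'M[int]_n) (r : 'rV[int]_n) (x : 'cV[int]_n) :
    \det M != 0 -> (forall i j, i != j -> M i j <= 0) -> in_scrR M r ->
    (forall i, 0 <= (M *m x) i 0) ->
  forall i, 0 <= x i 0.
Proof.
move=> dM offM [r_gt0 rM_ge0] Mx_ge0.
(* The negative part [y] of [x] satisfies [M y <= 0]; pairing with [r] then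
   forces [M y = 0]. *)
pose y : 'cV[int]_n := \col_i Num.max 0 (- x i 0).
have y_ge0 i : 0 <= y i 0 by rewrite mxE le_max lexx.
have y_geN i : - x i 0 <= y i 0 by rewrite mxE le_max lexx orbT.
have My_le0 i : (M *m y) i 0 <= 0.
  (* If [x i 0 < 0], then [y] equals [- x] at [i] and dominates it elsewhere, where [M] is
     nonpositive, so row [i] gives at most [- (M *m x) i 0]. Otherwise [y i 0 = 0] and only
     off-diagonal terms remain. *)
  case: (ltP (x i 0) 0) => xi.
    apply: (@le_trans _ _ (- (M *m x) i 0)); last by rewrite oppr_le0.
    rewrite ![(M *m _) i 0]mxE -sumrN; apply: ler_sum => j _; rewrite -mulrN.
    have [<-|/offM Mij] := eqVneq i j; last exact: ler_wnM2l.
    by rewrite [y i 0]mxE max_r // oppr_ge0 ltW.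
  rewrite [(M *m _) i 0]mxE; apply: sumr_le0 => j _.
  have [<-|/offM Mij] := eqVneq i j; last exact: mulr_le0_ge0.
  by rewrite [y i 0]mxE max_l ?mulr0 // oppr_le0.
have rMy : \sum_i - (r 0 i * (M *m y) i 0) = 0.
  apply/eqP; rewrite eq_le; apply/andP; split; last first.
    by apply: sumr_ge0 => i _; have := My_le0 i; have := r_gt0 i; nia.
  have -> : \sum_i - (r 0 i * (M *m y) i 0) = - ((r *m M) *m y) 0 0.
    by rewrite -mulmxA [in RHS]mxE sumrN.
  rewrite oppr_le0 mxE; apply: sumr_ge0 => i _.
  by apply: mulr_ge0; [exact: rM_ge0 | exact: y_ge0].
have y0 : y = 0.
  apply: (det_mulmx_eq0 dM); apply/colP => i; rewrite [RHS]mxE.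
  have term_ge0 k : true -> 0 <= - (r 0 k * (M *m y) k 0).
    by move=> _; have := My_le0 k; have := r_gt0 k; nia.
  have /eqP := @psumr_eq0P _ _ _ _ term_ge0 rMy i isT.
  by rewrite oppr_eq0 mulf_eq0 gt_eqF //= => /eqP.
by move=> i; have /colP/(_ i) := y0; rewrite !mxE; lia.
Qed.

(** The signed adjugate is an integral multiple of the inverse; [M] sends each of its columns to a
    nonnegative vector, so the columns are nonnegative. *)
Lemma inverse_ge0 (n : nat) (M : 'M[int]_n) (r : 'rV[int]_n) :
    \det M != 0 -> (forall i j, i != j -> M i j <= 0) -> in_scrR M r ->
  exists B : 'M[int]_n,
    [/\ forall i j, 0 <= B i j, B *m M = `|\det M|%:M & M *m B = `|\det M|%:M].
Proof.
move=> dM offM rM; exists (Num.sg (\det M) *: \adj M).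
have MB : M *m (Num.sg (\det M) *: \adj M) = `|\det M|%:M.
  by rewrite -scalemxAr mul_mx_adj scale_scalar_mx normrEsg.
split=> //; last by rewrite -scalemxAl mul_adj_mx scale_scalar_mx normrEsg.
move=> i j; have <- : col j (Num.sg (\det M) *: \adj M) i 0 = (Num.sg (\det M) *: \adj M) i j.
  by rewrite mxE.
apply: (mulmx_ge0_inv dM offM rM) => k.
by rewrite colE mulmxA MB -colE !mxE mulrn_wge0.
Qed.

(** * Toppling sequences, least action and stabilization *)

Definition score (n : nat) (s : seq 'I_n) : 'rV[int]_n := \row_j (count_mem j s)%:Z.

Lemma score_cons (n : nat) (i : 'I_n) (s : seq 'I_n) :
  score (i :: s) = delta_mx 0 i + score s.
Proof. by apply/rowP => j; rewrite !mxE /= PoszD eq_sym; case: (j == i). Qed.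

Lemma foldl_topple (n : nat) (M : 'M[int]_n) (u : 'rV[int]_n) (s : seq 'I_n) :
  foldl (topple M) u s = u - score s *m M.
Proof.
elim: s u => [|i s IHs] u /=.
  by rewrite (_ : score [::] = 0) ?mul0mx ?subr0 //; apply/rowP => j; rewrite !mxE.
by rewrite IHs score_cons mulmxDl -rowE opprD addrA.
Qed.

(** Induction on [s]. If [z] vanished at the first toppled vertex [i], subtracting [z *m M] could
    only raise the entry at [i], which would stay critical. So one toppling at [i] can be removed
    from both [s] and [z]. *)
Lemma least_action (n : nat) (M : 'M[int]_n) (u z : 'rV[int]_n) (s : seq 'I_n) :
    (forall i j, i != j -> M i j <= 0) -> legal_topplings M u s ->
    configuration z -> (forall i, ~~ critical M (u - z *m M) i) ->
  forall i, score s 0 i <= z 0 i.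
Proof.
move=> offM; elim: s u z => [|i s IHs] u z /=; first by move=> _ z0 _ i; rewrite mxE.
case/andP=> crit_i legal z_ge0 stab_z.
have zi_gt0 : 1 <= z 0 i.
  rewrite -gtz0_ge1 lt_def z_ge0 andbT; apply/negP => /eqP zi.
  move/negP: (stab_z i); apply; apply: (le_trans crit_i).
  rewrite !mxE lerDl oppr_ge0; apply: sumr_le0 => j _.
  have [->|/offM Mji] := eqVneq j i; first by rewrite zi mul0r.
  by rewrite mulr_ge0_le0.
move=> j; rewrite score_cons mxE -lerBrDl.
have := IHs (topple M u i) (z - delta_mx 0 i) legal.
move/(_ _ _ j); rewrite !mxE; apply.
  move=> k; rewrite !mxE /=; have := z_ge0 k.
  by case: (eqVneq k i) => [->|_] /=; lia.
by move=> k; rewrite /topple mulmxBl -rowE opprB addrA subrK; apply: stab_z.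
Qed.

Lemma legal_add (n : nat) (M : 'M[int]_n) (u x : 'rV[int]_n) (s : seq 'I_n) :
  configuration x -> legal_topplings M u s -> legal_topplings M (u + x) s.
Proof.
move=> x_ge0; elim: s u => //= i s IHs u /andP[crit_i /IHs].
rewrite /topple addrAC => ->; rewrite andbT /critical mxE.
by apply: (le_trans crit_i); rewrite lerDl.
Qed.

(** Extra grains keep topplings legal, so the sequence for [u] can run first while carrying [x]
    along. *)
Lemma topples_to_trans (n : nat) (M : 'M[int]_n) (u v w x : 'rV[int]_n) :
    configuration x -> topples_to M u v -> topples_to M (v + x) w ->
  topples_to M (u + x) w.
Proof.
move=> x_ge0 [s [s_legal ->]] [t [t_legal ->]].
rewrite foldl_topple in t_legal *.
exists (s ++ t); split; last by rewrite foldl_cat (foldl_topple _ _ s) addrAC.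
have := legal_add x_ge0 s_legal; rewrite addrAC in t_legal.
elim: s (u + x) t_legal {s_legal} => [|i s IHs] y.
  by rewrite -(foldl_topple _ _ [::]).
rewrite -foldl_topple /= foldl_topple => t_legal /andP[-> /IHs]; exact.
Qed.

Lemma topple_configuration (n : nat) (M : 'M[int]_n) (u : 'rV[int]_n) (i : 'I_n) :
    (forall i j, i != j -> M i j <= 0) -> configuration u -> critical M u i ->
  configuration (topple M u i).
Proof.
move=> offM u_ge0 crit_i j; rewrite !mxE subr_ge0.
have [<-//|/offM Mij] := eqVneq i j.
exact: le_trans Mij (u_ge0 j).
Qed.

Lemma stabilizable (n : nat) (M : 'M[int]_n) (r u : 'rV[int]_n) :
    \det M != 0 -> (forall i j, i != j -> M i j <= 0) -> in_scrR M r ->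
    configuration u ->
  exists v, topples_to M u v /\ stable M v.
Proof.
move=> dM offM rM; have [B [B_ge0 _ MB]] := inverse_ge0 dM offM rM.
(* Each toppling lowers the weight [u w] by [`|\det M|]. *)
pose w : 'cV[int]_n := B *m const_mx 1.
have Mw i : (M *m w) i 0 = `|\det M|.
  by rewrite mulmxA MB mul_scalar_mx !mxE mulr1.
have w_ge0 i : 0 <= w i 0.
  by rewrite mxE sumr_ge0 // => j _; rewrite mxE mulr1.
have [k] := ubnP (absz ((u *m w) 0 0)); elim: k u => // k IHk u leuk u_ge0.
have [/existsP[i crit_i]|/existsPn stab_u] := boolP [exists i, critical M u i]; last first.
  by exists u; split=> //; exists [::].
have top_ge0 := topple_configuration offM u_ge0 crit_i.
have weight_ge0 (x : 'rV[int]_n) : configuration x -> 0 <= (x *m w) 0 0.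
  by move=> x_ge0; rewrite mxE sumr_ge0 // => j _; rewrite mulr_ge0.
have [||v [[s [s_legal ->]] stab_v]] := IHk (topple M u i) => //.
  have weight_topple : (topple M u i *m w) 0 0 = (u *m w) 0 0 - `|\det M|.
    by rewrite /topple mulmxBl -row_mul -(Mw i); move: (u *m w) (M *m w) => a b; rewrite !mxE.
  have := weight_ge0 _ top_ge0; have := weight_ge0 _ u_ge0.
  by rewrite weight_topple; lia.
by exists (foldl (topple M) (topple M u i) s); split=> //; exists (i :: s); rewrite /= crit_i.
Qed.

(** All [k] grains can be added in advance: waiting grains do not obstruct earlier topplings. *)
Lemma iter_avalanche (n : nat) (M : 'M[int]_n) (r u : 'rV[int]_n) (i : 'I_n) (k : nat) :
    \det M != 0 -> (forall i j, i != j -> M i j <= 0) -> in_scrR M r ->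
    stable M u ->
  topples_to M (u + delta_mx 0 i *+ k) (iter k (avalanche M i) u) /\
  stable M (iter k (avalanche M i) u).
Proof.
move=> dM offM rM stab_u; elim: k => [|k [IHk stab_k]] /=.
  by split=> //; exists [::]; rewrite addr0.
have e_ge0 : configuration (delta_mx 0 i : 'rV[int]_n).
  by move=> j; rewrite mxE; case: (_ && _).
have ske_ge0 : configuration (iter k (avalanche M i) u + delta_mx 0 i).
  by move=> j; rewrite mxE addr_ge0 // (proj1 stab_k).
have [step stab_step] := epsilon_spec (inhabits (iter k (avalanche M i) u + delta_mx 0 i)) _
  (stabilizable dM offM rM ske_ge0).
by split=> //; rewrite mulrSr addrA; apply: topples_to_trans IHk step.
Qed.

Lemma topples_to_add (n : nat) (M : 'M[int]_n) (u x y : 'rV[int]_n) :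
    configuration y -> topples_to M (u + x) u -> topples_to M (u + y) u ->
  topples_to M (u + (x + y)) u.
Proof. by move=> y_ge0 ux uy; rewrite addrA; apply: topples_to_trans ux uy. Qed.

Lemma topples_to_sum (n : nat) (M : 'M[int]_n) (u : 'rV[int]_n) (I : finType)
    (x : I -> 'rV[int]_n) :
    (forall i, configuration (x i)) -> (forall i, topples_to M (u + x i) u) ->
  topples_to M (u + \sum_i x i) u.
Proof.
move=> x_ge0 ux.
suff [] : configuration (\sum_i x i) /\ topples_to M (u + \sum_i x i) u by [].
apply: (big_ind (fun y => configuration y /\ topples_to M (u + y) u)) => //.
  by split=> [i|]; [rewrite mxE | exists [::]; rewrite addr0].
move=> y y' [y_ge0 uy] [y'_ge0 uy']; split; last exact: topples_to_add.
by move=> i; rewrite mxE addr_ge0.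
Qed.

(** * Recurrence versus allowedness *)

Lemma returning_critical (n : nat) (M : 'M[int]_n) (u z chi : 'rV[int]_n) :
    \det M != 0 -> (forall i j, i != j -> M i j <= 0) ->
    (forall i, 0 < z 0 i) -> configuration (z *m M) -> topples_to M (u + z *m M) u ->
    configuration chi -> (exists i, chi 0 i != 0) ->
  exists i, critical M (u + chi *m M) i.
Proof.
move=> dM offM z_gt0 zM_ge0 u_ret chi_ge0 [i0 chi_i0].
have [/existsP//|/existsPn stab_chi] := boolP [exists i, critical M (u + chi *m M) i].
(* Each entry of [chi] is at most [m], and the entries of [z] are at least 1, so [chi] is bounded by
   [z *+ m]. *)
pose m := (\sum_i absz (chi 0%R i))%N.
have chi_le i : chi 0 i <= (z *+ m) 0 i.
  have : (absz (chi 0%R i) <= m)%N by rewrite /m (bigD1 i) //= leq_addr.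
  rewrite -lez_nat gez0_abs // => /le_trans; apply.
  by rewrite mulmxnE -mulr_natr natz ler_peMl // -gtz0_ge1.
have u_ret_m : topples_to M (u + (z *+ m) *m M) u.
  have := topples_to_sum (fun _ : 'I_m => zM_ge0) (fun _ => u_ret).
  by rewrite sumr_const card_ord -scaler_nat scalemxAl scaler_nat.
have [s [s_legal]] := u_ret_m; rewrite foldl_topple => eq_u.
(* As [M] is nonsingular, the endpoints determine the score. *)
have score_s : score s = z *+ m.
  apply: (det_mulmx_inj dM) => /=.
  by move/eqP: eq_u; rewrite eq_sym subr_eq => /eqP/addrI ->.
have := least_action (z := z *+ m - chi) offM s_legal _ _ i0.
rewrite score_s => le_i0.
have : (z *+ m) 0 i0 <= (z *+ m - chi) 0 i0.
  apply: le_i0 => i; first by rewrite [X in 0 <= X]mxE [X in _ + X]mxE subr_ge0.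
  by rewrite mulmxBl opprB addrA addrAC addrK.
rewrite [X in _ <= X]mxE [X in _ + X]mxE lerDl oppr_ge0.
by move=> chi_le0; case/negP: chi_i0; rewrite eq_le chi_le0 chi_ge0.
Qed.

Lemma recurrent_allowed (n : nat) (M : 'M[int]_n) (r u : 'rV[int]_n) :
    \det M != 0 -> (forall i j, i != j -> M i j <= 0) -> in_scrR M r ->
    recurrent M u ->
  allowed M r u.
Proof.
move=> dM offM rM [stab_u [c rec_u]].
have [u_ge0 ncrit_u] := stab_u; split=> // chi [chi_r chi_neq0].
have chi_ge0 : configuration chi by move=> i; case/andP: (chi_r i).
(* Adding [c i] grains at every vertex [i] together still returns to [u]. *)
pose x := \sum_i (delta_mx 0 i *+ c i : 'rV[int]_n).
have xE i : x 0 i = (c i)%:Z.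
  rewrite summxE (bigD1 i) //= big1 ?addr0 => [|j /negPf ji].
    by rewrite mulmxnE mxE !eqxx; exact: natz.
  by rewrite mulmxnE mxE eq_sym ji andbF mul0rn.
have u_ret : topples_to M (u + x) u.
  apply: topples_to_sum => i; first by move=> j; rewrite mulmxnE mxE mulrn_wge0 // ler0n.
  by have [] := iter_avalanche i (c i) dM offM rM stab_u; rewrite (proj2 (rec_u i)).
have [s [_]] := u_ret; rewrite foldl_topple => eq_u.
have scoreM : score s *m M = x.
  by move/eqP: eq_u; rewrite eq_sym subr_eq => /eqP/addrI ->.
have score_ge0 i : 0 <= score s 0 i by rewrite mxE.
(* A vertex that never topples could only gain grains, yet [score s *m M] must remove the [c i]
   grains added there. *)
have score_gt0 i : 0 < score s 0 i.
  rewrite lt_def score_ge0 andbT; apply/eqP => si0.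
  have : 0 < (score s *m M) 0 i by rewrite scoreM xE ltz_nat; case: (rec_u i).
  rewrite ltNge mxE sumr_le0 // => j _.
  have [->|/offM Mji] := eqVneq j i; first by rewrite si0 mul0r.
  by rewrite mulr_ge0_le0.
have x_ge0 : configuration x by move=> i; rewrite xE.
rewrite -scoreM in x_ge0 u_ret.
have [j crit_j] := returning_critical dM offM score_gt0 x_ge0 u_ret chi_ge0 chi_neq0.
rewrite /critical [X in _ <= X]mxE in crit_j.
exists j; split; last by rewrite lerBlDr; move: crit_j; rewrite mxE.
(* If [chi] vanished at [j], then [chi *m M] would be nonpositive there and [j] already critical in
   [u]. *)
rewrite -gtz0_ge1 lt_def chi_ge0 andbT; apply/eqP => chij.
move/negP: (ncrit_u j); apply; apply: le_trans crit_j _.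
rewrite gerDl mxE sumr_le0 // => i _.
have [->|/offM Mij] := eqVneq i j; first by rewrite chij mul0r.
by rewrite mulr_ge0_le0.
Qed.

Lemma allowed_returns (n : nat) (M : 'M[int]_n) (r u : 'rV[int]_n) :
    \det M != 0 -> (forall i j, i != j -> M i j <= 0) -> in_scrR M r ->
    stable M u -> allowed M r u ->
  topples_to M (u + r *m M) u.
Proof.
move=> dM offM rM [u_ge0 ncrit_u] [_ allow_u]; have [r_gt0 rM_ge0] := rM.
have v_ge0 : configuration (u + r *m M) by move=> i; rewrite mxE addr_ge0.
have [v [[s [s_legal ->]] [_ ncrit_v]]] := stabilizable dM offM rM v_ge0.
suff eq_sr : score s = r by exists s; rewrite foldl_topple eq_sr addrK.
(* Least action against [r], which leads back to the stable [u]. *)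
have le_sr : forall i, score s 0 i <= r 0 i.
  apply: (least_action offM s_legal) => [i|i]; first exact/ltW.
  by rewrite addrK.
apply/eqP; rewrite eq_sym -subr_eq0; apply/negPn/negP => /rV0Pn neq_sr.
have [|j [_ chi_j]] := allow_u (r - score s).
  split=> [i|//].
  have := le_sr i; have : 0 <= score s 0 i by rewrite mxE.
  have -> : (r - score s) 0 i = r 0 i - score s 0 i by rewrite !mxE.
  lia.
move/negP: (ncrit_v j); apply.
rewrite foldl_topple -addrA -mulmxBl /critical [X in _ <= X]mxE -lerBlDr.
by rewrite [X in _ - X]mxE.
Qed.

Lemma allowed_recurrent (n : nat) (M : 'M[int]_n) (r u : 'rV[int]_n) :
    \det M != 0 -> (forall i j, i != j -> M i j <= 0) -> in_scrR M r ->
    stable M u -> allowed M r u ->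
  recurrent M u.
Proof.
move=> dM offM rM stab_u allow_u; split=> //.
have [B [B_ge0 BM _]] := inverse_ge0 dM offM rM.
exists (fun=> `|\det M|%N) => i; split; first by rewrite absz_gt0.
have [[s [s_legal ->]] [_ ncrit_v]] := iter_avalanche i `|\det M| dM offM rM stab_u.
(* This explains the exponent: [|det M|] grains at one vertex form an integral combination of the
   rows of [M], with nonnegative coefficients. *)
have eB : delta_mx 0 i *+ `|\det M| = row i B *m M.
  rewrite -row_mul BM; apply/rowP => j; rewrite mulmxnE !mxE /= [j == i]eq_sym.
  by case: (i == j); [rewrite mulr1n -abszE -[RHS]natz | rewrite [LHS]mul0rn].
rewrite foldl_topple eB -addrA -mulmxBl in s_legal ncrit_v *.
have le_sB : forall j, score s 0 j <= row i B 0 j.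
  apply: (least_action offM s_legal) => j; first by rewrite mxE.
  by rewrite addrK; case: stab_u.
have [->|/rV0Pn chi_neq0] := eqVneq (row i B - score s) 0; first by rewrite mul0mx addr0.
have [r_gt0 rM_ge0] := rM.
have chi_ge0 : configuration (row i B - score s).
  by move=> j; rewrite [X in 0 <= X]mxE [X in _ + X]mxE subr_ge0.
(* A nonzero difference [row i B - score s] would leave a critical vertex in the stable
   configuration reached. *)
have [j crit_j] := returning_critical dM offM r_gt0 rM_ge0
  (allowed_returns dM offM rM stab_u allow_u) chi_ge0 chi_neq0.
by move: (ncrit_v j); rewrite crit_j.
Qed.

Theorem corollary3p9 (n : nat) (n_ge1 : (1 <= n)%N) (Delta : 'M[int]_n)
    (Delta_det : \det Delta != 0)
    (Delta_offdiag : forall i j : 'I_n, i != j -> Delta i j <= 0)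
    (Delta_scrR : exists r0 : 'rV[int]_n, in_scrR Delta r0)
    (r : 'rV[int]_n) (r_scrR : in_scrR Delta r)
    (u : 'rV[int]_n) (u_conf : configuration u) :
  recurrent Delta u <-> stable Delta u /\ allowed Delta r u.
Proof.
split=> [rec_u|[stab_u allow_u]]; last exact: allowed_recurrent allow_u.
by split; [case: rec_u | apply: recurrent_allowed rec_u].
Qed.
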